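(* Let $(\mathcal{S},\mathcal{A},P,r,d_0,\gamma)$ be an infinite-horizon discounted Markov decision process with finite state set $\mathcal{S}$, finite action set $\mathcal{A}$, and discount factor $\gamma\in[0,1)$. Let $f:\mathcal{S}\to\mathbb{R}$ be any function and define $$A(s,a) = r(s,a) + \gamma\,\mathbb{E}_{s'\sim P(\cdot\mid s,a)}[f(s')] - f(s).$$ Let $\pi$ and $\tilde{\pi}$ be any two stochastic policies, where $\pi(a\mid s)>0$ for all $(s,a)$ so that the ratios $\tilde{\pi}(a\mid s)/\pi(a\mid s)$ are defined. Put $$G_\pi(\tilde{\pi}) = \sum_{s\in\mathcal{S}} d_\pi(s)\sum_{a\in\mathcal{A}}\pi(a\mid s)\left(\frac{\tilde{\pi}(a\mid s)}{\pi(a\mid s)}-1\right)A(s,a),$$ $$\delta = \max_{s,a}\left|\left(\frac{\tilde{\pi}(a\mid s)}{\pi(a\mid s)}-1\right)A(s,a)\right|,\qquad \epsilon = \max_{s}\left|\sum_{a}\pi(a\mid s)A(s,a)\right|.$$ Then $$J(\tilde{\pi}) - J(\pi) \;\geq\; G_\pi(\tilde{\pi}) - \frac{2\gamma}{1-\gamma}\,(\delta+\epsilon).$$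
   Context: The Markov decision process consists of a finite state set $\mathcal{S}$, a finite action set $\mathcal{A}$, a transition kernel $P(\cdot\mid s,a)$ (a probability distribution on $\mathcal{S}$ for each $(s,a)\in\mathcal{S}\times\mathcal{A}$), a reward function $r:\mathcal{S}\times\mathcal{A}\to\mathbb{R}$, an initial state distribution $d_0$ on $\mathcal{S}$, and a discount factor $\gamma\in[0,1)$. A stochastic policy $\pi$ assigns to each state $s$ a probability distribution $\pi(\cdot\mid s)$ on $\mathcal{A}$. The performance of $\pi$ is $$J(\pi)=\mathbb{E}\Big[\sum_{t=0}^\infty \gamma^t r(s_t,a_t)\Big],\qquad s_0\sim d_0,\ a_t\sim\pi(\cdot\mid s_t),\ s_{t+1}\sim P(\cdot\mid s_t,a_t).$$ The (unnormalized) discounted state distribution of $\pi$ is $d_\pi(s)=\sum_{t=0}^\infty\gamma^t\,\Pr(s_t=s\mid\pi,d_0)$, where $\Pr(s_t=s\mid \pi,d_0)$ is the probability that the state at time $t$ is $s$ when $s_0\sim d_0$ and actions follow $\pi$; thus $\sum_s d_\pi(s)=1/(1-\gamma)$. The notation $\mathbb{E}_{s\sim d_\pi,\,a\sim\pi(\cdot\mid s)}[g(s,a)]$ means the weighted sum $\sum_s d_\pi(s)\sum_a\pi(a\mid s)g(s,a)$. *)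

(* Defs.v *)
From HB Require Import structures.
From mathcomp Require Import all_boot all_order all_algebra.
From mathcomp Require Import all_classical all_reals all_analysis.

Set Implicit Arguments.
Unset Strict Implicit.
Unset Printing Implicit Defensive.

Import Order.TTheory GRing.Theory Num.Theory.
Import numFieldNormedType.Exports.

Local Open Scope classical_set_scope.
Local Open Scope ring_scope.

Record distr (R : realType) (T : finType) := Distr {
  pmf :> T -> R;
  pmf_ge0 : forall x, 0 <= pmf x;
  pmf_sum1 : \sum_x pmf x = 1 }.

Record mdp (R : realType) (S A : finType) := MDP {
  trans : S -> A -> distr R S;
  reward : S -> A -> R;
  init : distr R S;
  discount : R;
  discount_ge0 : 0 <= discount;
  discount_lt1 : discount < 1 }.

Definition policy (R : realType) (S A : finType) := S -> distr R A.

(* The event that the first n state-action pairs are (x 0, b 0), ...,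
   (x n.-1, b n.-1). *)
Definition history (S A : finType) (Omega : Type) (s : nat -> Omega -> S)
    (a : nat -> Omega -> A) (n : nat) (x : nat -> S) (b : nat -> A) :
    set Omega :=
  [set w | forall i, (i < n)%N -> s i w = x i /\ a i w = b i].

(* A random trajectory s_0, a_0, s_1, a_1, ... of M under pi, on an arbitrary
   probability space: s_0 ~ d_0, a_t ~ pi(. | s_t), s_(t+1) ~ P(. | s_t, a_t).
   The last two laws are conditional on the whole past, and are written as
   products so that pasts of probability zero need no special treatment.
   The three laws determine the distribution of the process; see
   TrajectoryExistence.trajectory_exists for existence. *)
Record trajectory (R : realType) (S A : finType) (M : mdp R S A)
    (pi : policy R S A) := Trajectory {
  disp : measure_display;
  space : measurableType disp;
  prob : probability space R;
  state : nat -> space -> S;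
  action : nat -> space -> A;
  measurable_state : forall t x, measurable (state t @^-1` [set x]);
  measurable_action : forall t b, measurable (action t @^-1` [set b]);
  law_init : forall x, prob (state 0%N @^-1` [set x]) = (init M x)%:E;
  law_action : forall t (x : nat -> S) (b : nat -> A),
    prob (history state action t x b `&` state t @^-1` [set x t]
          `&` action t @^-1` [set b t]) =
    (prob (history state action t x b `&` state t @^-1` [set x t])
     * (pi (x t) (b t))%:E)%E;
  law_state : forall t (x : nat -> S) (b : nat -> A),
    prob (history state action t.+1 x b `&` state t.+1 @^-1` [set x t.+1]) =
    (prob (history state action t.+1 x b)
     * (trans M (x t) (b t) (x t.+1))%:E)%E }.

Arguments space {R S A M pi} X : rename.
Arguments prob {R S A M pi} X : rename.
Arguments state {R S A M pi} X t w : rename.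
Arguments action {R S A M pi} X t w : rename.

Section performance.
Variables (R : realType) (S A : finType) (M : mdp R S A).

(* The return is bounded by max |r| / (1 - gamma), so its expectation is
   finite and [fine] loses nothing. *)
Definition J (pi : policy R S A) (X : trajectory M pi) : R :=
  fine 'E_(prob X)[fun w => limn (series (fun t =>
    discount M ^+ t * reward M (state X t w) (action X t w)))].

Definition dstate (pi : policy R S A) (X : trajectory M pi) (x : S) : R :=
  limn (series (fun t =>
    discount M ^+ t * fine (prob X (state X t @^-1` [set x])))).

Definition adv (f : S -> R) (x : S) (b : A) : R :=
  reward M x b + discount M * (\sum_y trans M x b y * f y) - f x.

Definition G (f : S -> R) (pi pi' : policy R S A) (X : trajectory M pi) : R :=
  \sum_x dstate X x * \sum_b pi x b * ((pi' x b / pi x b - 1) * adv f x b).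

(* In both maxima the terms are nonnegative, and S and A are nonempty because
   they carry probability distributions; the default value 0 is harmless. *)
Definition delta (f : S -> R) (pi pi' : policy R S A) : R :=
  \big[Num.max/0]_(p : S * A)
    `|(pi' p.1 p.2 / pi p.1 p.2 - 1) * adv f p.1 p.2|.

Definition epsilon (f : S -> R) (pi : policy R S A) : R :=
  \big[Num.max/0]_(x : S) `|\sum_b pi x b * adv f x b|.

End performance.

(* Every policy admits a trajectory, so quantifying over trajectories is not
   vacuous. On [0, 1[ with the Lebesgue measure, nested subintervals encode the
   histories, the length of each being the probability of its history. *)
Module TrajectoryExistence.

Section cells.
Variables (R : realType) (Z : finType) (p : distr R Z).

Let cum (z : Z) : R := \sum_(y | (enum_rank y < enum_rank z)%N) p y.

Definition cell (l w u : R) (z : Z) : bool :=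
  l + w * cum z <= u < l + w * (cum z + p z).

Lemma cum_le (z y : Z) :
  (enum_rank z < enum_rank y)%N -> cum z + p z <= cum y.
Proof.
move=> zy; rewrite /cum [leRHS](bigD1 z)//= [leLHS]addrC lerD2l.
rewrite [leRHS]big_mkcond [leLHS]big_mkcond; apply: ler_sum => x _.
case: ifP => [xz|_]; last by case: ifP => // _; exact: pmf_ge0.
rewrite (ltn_trans xz zy)/=; case: eqP => [xE|//].
by move: xz; rewrite xE ltnn.
Qed.

Lemma cum_ge0 z : 0 <= cum z.
Proof. by apply: sumr_ge0 => y _; exact: pmf_ge0. Qed.

Lemma cumD_le1 z : cum z + p z <= 1.
Proof.
rewrite -(pmf_sum1 p) (bigD1 z)//= [leLHS]addrC lerD2l /cum.
rewrite [leRHS]big_mkcond [leLHS]big_mkcond; apply: ler_sum => x _.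
case: ifP => [xz|_]; last by case: ifP => // _; exact: pmf_ge0.
by case: eqP => [xE|//]; move: xz; rewrite xE ltnn.
Qed.

Lemma cell_sub l w u z : 0 <= w -> cell l w u z -> l <= u < l + w.
Proof.
move=> w0 /andP[h1 h2]; apply/andP; split.
  by apply: le_trans h1; rewrite lerDl mulr_ge0// cum_ge0.
by apply: lt_le_trans h2 _; rewrite lerD2l ler_piMr// cumD_le1.
Qed.

Lemma cell_inj l w u z y : 0 <= w -> cell l w u z -> cell l w u y -> z = y.
Proof.
move=> w0; wlog zy : z y / (enum_rank z <= enum_rank y)%N => [H h1 h2|].
  case/orP: (leq_total (enum_rank z) (enum_rank y)) => zy; first exact: H.
  by apply/esym/H.
move: zy; rewrite leq_eqVlt => /orP[/eqP/ord_inj/enum_rank_inj//|zy].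
move=> /andP[_ h1] /andP[h2 _].
have := lt_le_trans (le_lt_trans h2 h1)
  (lexx _); rewrite ltrD2l ltNge ler_wpM2l//; exact: cum_le.
Qed.

Lemma cell_cover l w u : 0 <= w -> l <= u < l + w -> exists z, cell l w u z.
Proof.
move=> w0 /andP[lu ul].
have [|noz] := boolP [exists z, l + w * (cum z + p z) > u]; last first.
  exfalso; have [z0 _|Z0] := pickP (fun _ : Z => true); last first.
    have := pmf_sum1 p; rewrite big_pred0// => /eqP.
    by rewrite eq_sym oner_eq0.
  case: (arg_maxnP (fun z : Z => val (enum_rank z)) (isT : xpredT z0)).
  move=> z _ zmax.
  move: noz; rewrite negb_exists => /forallP/(_ z); apply/negP/negPn.
  suff -> : cum z + p z = 1 by rewrite mulr1.
  rewrite -(pmf_sum1 p) [RHS](bigD1 z)//= addrC; congr (_ + _).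
  apply: eq_bigl => y; have yz := zmax y isT.
  rewrite ltn_neqAle; move: yz => /= ->; rewrite andbT.
  by rewrite (inj_eq (@ord_inj _)) (inj_eq enum_rank_inj).
move=> /existsP[z1 h1].
case: (@arg_minnP _ z1 (fun z => u < l + w * (cum z + p z))
  (fun z : Z => val (enum_rank z)) h1) => z hz zmin.
exists z; rewrite /cell hz andbT.
have [z0|] := posnP (enum_rank z).
  by rewrite /cum big_pred0 ?mulr0 ?addr0// => y; rewrite z0.
move=> zgt; pose y := enum_val (Ordinal (leq_ltn_trans (leq_pred _)
  (ltn_ord (enum_rank z)))).
have ry : enum_rank y = (enum_rank z).-1 :> nat by rewrite enum_valK.
have -> : cum z = cum y + p y.
  rewrite {1}/cum (bigD1 y)/=; last by rewrite ry prednK.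
  rewrite addrC; congr (_ + _); apply: eq_bigl => x.
  rewrite -(inj_eq enum_rank_inj) -(inj_eq (@ord_inj _)) ry.
  by rewrite -[X in (_ < X)%N](prednK zgt) ltnS ltn_neqAle andbC.
rewrite leNgt; apply/negP => /zmin /=; rewrite ry.
by rewrite -[X in (X <= _)%N](prednK zgt) ltnn.
Qed.

End cells.

Section process.
Variables (R : realType) (Z : finType) (z0 : Z) (q : seq Z -> distr R Z).

Fixpoint ival (n : nat) (z : nat -> Z) : R * R :=
  if n is m.+1 then
    let p := q (mkseq z m) in
    ((ival m z).1 + (ival m z).2
        * (\sum_(y | (enum_rank y < enum_rank (z m))%N) p y),
     (ival m z).2 * p (z m))
  else (0, 1).

Definition inI n z (u : R) := (ival n z).1 <= u < (ival n z).1 + (ival n z).2.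

Lemma ival_ge0 n z : 0 <= (ival n z).2.
Proof. by elim: n => [|n IH]//=; rewrite mulr_ge0// pmf_ge0. Qed.

Lemma ival2E n z : (ival n z).2 = \prod_(i < n) q (mkseq z i) (z i).
Proof. by elim: n => [|n IH]; rewrite ?big_ord0// big_ord_recr/= -IH. Qed.

Lemma inIS n z u :
  inI n.+1 z u = cell (q (mkseq z n)) (ival n z).1 (ival n z).2 u (z n).
Proof. by rewrite /inI /cell/= -addrA -mulrDr. Qed.

Lemma eq_mkseq (n : nat) (z z' : nat -> Z) :
  (forall i, (i < n)%N -> z i = z' i) -> mkseq z n = mkseq z' n.
Proof. by move=> h; apply/eq_in_map => i; rewrite mem_iota => /h. Qed.

Lemma eq_ival n z z' :
  (forall i, (i < n)%N -> z i = z' i) -> ival n z = ival n z'.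
Proof.
elim: n => // n IH h /=.
have h' i : (i < n)%N -> z i = z' i by move=> /ltnW; exact: h.
by rewrite (IH h') (eq_mkseq h') (h n).
Qed.

Lemma inI_le n z u m : (m <= n)%N -> inI n z u -> inI m z u.
Proof.
move=> /subnK <-; elim: (n - m)%N => // k IH; rewrite addSn inIS => h.
by apply: IH; apply: (cell_sub _ h); exact: ival_ge0.
Qed.

Lemma inI_inj n z z' u : inI n z u -> inI n z' u ->
  forall i, (i < n)%N -> z i = z' i.
Proof.
elim: n => // n IH h h'.
have H := IH (inI_le (leqnSn n) h) (inI_le (leqnSn n) h').
move=> i; rewrite ltnS leq_eqVlt => /orP[/eqP ->|]; last exact: H.
move: h'; rewrite inIS -(eq_ival H) -(eq_mkseq H).
by move: h; rewrite inIS; apply: cell_inj; exact: ival_ge0.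
Qed.

Lemma path_exists u : 0 <= u < 1 -> exists z, forall n, inI n z u.
Proof.
move=> u01.
pose upd (h : nat -> Z) n c : nat -> Z := fun i => if i == n then c else h i.
pose next h n := xget z0 [set c | inI n.+1 (upd h n c) u].
pose F := fix F n := if n is m.+1 then upd (F m) m (next (F m) m)
  else (fun=> z0).
have updE h n c i : (i < n)%N -> upd h n c i = h i.
  by move=> i_n; rewrite /upd ltn_eqF.
have FE n : inI n (F n) u.
  elim: n => [|n IH]; first by rewrite /inI/= add0r.
  rewrite /= /next; case: xgetP => [c _ //|].
  have [c hc] := @cell_cover _ _ (q (mkseq (F n) n)) _ _ _ (ival_ge0 n (F n)) IH.
  move=> /(_ c); case => /=; rewrite inIS.
  rewrite (eq_ival (z' := F n)); last by move=> i /updE.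
  rewrite (eq_mkseq (z' := F n)); last by move=> i /updE.
  by rewrite /upd eqxx.
exists (fun n => F n.+1 n) => n.
have E m k : (k < m)%N -> F m k = F k.+1 k.
  elim: m => // m IH; rewrite ltnS leq_eqVlt => /orP[/eqP -> //|km].
  by rewrite /= updE// IH.
rewrite /inI (eq_ival (z' := F n)); first exact: FE.
by move=> i i_n; rewrite E.
Qed.

Definition proc (t : nat) (u : R) : Z :=
  xget (fun=> z0) [set z | forall n, inI n z u] t.

Lemma procP u n : 0 <= u < 1 -> inI n (proc^~ u) u.
Proof.
move=> u01; rewrite /proc; case: xgetP => [z -> h|]; first exact: h.
by have [z hz] := path_exists u01 => /(_ z).
Qed.

Lemma proc_out t u : ~~ (0 <= u < 1) -> proc t u = z0.
Proof.
move=> u01; rewrite /proc; case: xgetP => [z _ /(_ 0%N)|//].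
by rewrite /inI/= add0r (negPf u01).
Qed.

Lemma inI01 n z u : inI n z u -> 0 <= u < 1.
Proof. by move=> /(inI_le (leq0n n)); rewrite /inI/= add0r. Qed.

Lemma inI_proc n z u : 0 <= u < 1 ->
  inI n z u <-> forall i, (i < n)%N -> proc i u = z i.
Proof.
move=> u01; split => [h|h].
  exact: inI_inj (procP n u01) h.
by rewrite /inI -(eq_ival h); exact: procP.
Qed.

Let I01 : set R := `[0, 1[%classic.

Lemma inIE n z : [set u | inI n z u] =
  `[(ival n z).1, (ival n z).1 + (ival n z).2[%classic.
Proof. by apply/seteqP; split => u /=; rewrite in_itv. Qed.

Lemma measurable_I01 : measurable (I01 : set (measurableTypeR R)).
Proof. exact: measurable_itv. Qed.

Lemma measurable_inI n z :
  measurable ([set u | inI n z u] : set (measurableTypeR R)).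
Proof. by rewrite inIE; exact: measurable_itv. Qed.

Lemma measurable_proc t z :
  measurable (proc t @^-1` [set z] : set (measurableTypeR R)).
Proof.
have -> : proc t @^-1` [set z] =
    (\bigcup_(h in [set h : {ffun 'I_t.+1 -> Z} | h ord_max = z])
      [set u | inI t.+1 (fun i => h (inord i)) u]) `|`
    (if z0 == z then ~` I01 else set0).
  apply/seteqP; split => u /=.
    move=> uz; have [u01|u01] := boolP (0 <= u < 1).
      left; exists [ffun i : 'I_t.+1 => proc i u]; first by rewrite /= ffunE.
      rewrite /= inI_proc// => i it; by rewrite ffunE inordK.
    right; move: uz; rewrite proc_out// => ->; rewrite eqxx.
    by rewrite /I01/= in_itv/=; apply/negP.
  case=> [[h /= hz hu]|].
    have [+ _] := inI_proc t.+1 (fun i => h (inord i)) (inI01 hu).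
    move=> /(_ hu t (ltnSn t)) ->; rewrite -hz; congr (h _).
    by apply/val_inj; rewrite /= inordK.
  case: eqP => // zz; rewrite /I01/= in_itv/= => /negP u01.
  by rewrite proc_out.
apply: measurableU.
  by apply: fin_bigcup_measurable => // h _; exact: measurable_inI.
by case: ifP => _ //; apply: measurableC; exact: measurable_I01.
Qed.

Definition unif : set (measurableTypeR R) -> \bar R :=
  mrestr (@lebesgue_measure R) measurable_I01.

HB.instance Definition _ := Measure.on unif.

Lemma unifT : unif setT = 1%E.
Proof.
rewrite /unif /mrestr setTI /I01 lebesgue_measure_itv/= lte_fin ltr01.
by rewrite oppr0 adde0.
Qed.

HB.instance Definition _ := Measure_isProbability.Build _ _ _ unif unifT.

Definition unifP : probability (measurableTypeR R) R := unif.

Lemma unif_proc n z :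
  unifP [set u | forall i, (i < n)%N -> proc i u = z i] =
  (\prod_(i < n) q (mkseq z i) (z i))%:E.
Proof.
rewrite /unifP/= /unif /mrestr -ival2E.
transitivity (lebesgue_measure [set u | inI n z u]).
  congr (lebesgue_measure _); apply/seteqP; split => u /=.
    by move=> [h]; rewrite /I01/= in_itv/= => u01; apply/inI_proc.
  move=> h; split; last by rewrite /I01/= in_itv/=; exact: inI01 h.
  exact/(inI_proc _ _ (inI01 h)).
rewrite inIE lebesgue_measure_itv/= lte_fin ltrDl.
have := ival_ge0 n z; rewrite le_eqVlt => /orP[/eqP <-|->].
  by rewrite ltxx.
by rewrite -EFinB addrAC subrr add0r.
Qed.

End process.

Section existence.
Variables (R : realType) (S A : finType) (M : mdp R S A) (pi : policy R S A).

Lemma distr_inhabited (T : finType) (p : distr R T) : inhabited T.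
Proof.
have [x _|T0] := pickP (fun _ : T => true); first by constructor.
by have := pmf_sum1 p; rewrite big_pred0// => /eqP; rewrite eq_sym oner_eq0.
Qed.

(* The law of the next state given the past state-action pairs. *)
Definition next_state (h : seq (S * A)) : distr R S :=
  if h is z :: h' then let y := last z h' in trans M y.1 y.2 else init M.

Definition step_pmf h (z : S * A) : R := next_state h z.1 * pi z.1 z.2.

Lemma step_ge0 h z : 0 <= step_pmf h z.
Proof. by apply: mulr_ge0; exact: pmf_ge0. Qed.

Lemma step_sum1 h : \sum_z step_pmf h z = 1.
Proof.
rewrite -(pair_bigA _ (fun x b => next_state h x * pi x b))/=.
under eq_bigr do rewrite -mulr_sumr pmf_sum1 mulr1.
exact: pmf_sum1.
Qed.

Definition step h := Distr (step_ge0 h) (step_sum1 h).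

Lemma next_stateS (z : nat -> S * A) n :
  next_state (mkseq z n.+1) = trans M (z n).1 (z n).2.
Proof.
suff -> : mkseq z n.+1 = rcons (mkseq z n) (z n).
  by case: (mkseq z n) => [|y s]//=; rewrite last_rcons.
by rewrite /mkseq -addn1 iotaD map_cat/= cats1 add0n.
Qed.

Lemma trajectory_exists : inhabited (trajectory M pi).
Proof.
have [x0] := distr_inhabited (init M).
have [b0] := distr_inhabited (pi x0).
pose X := proc (x0, b0) step.
pose s t u := (X t u).1; pose a t u := (X t u).2.
have mX t z : measurable (X t @^-1` [set z] : set (measurableTypeR R)).
  exact: measurable_proc.
have ms t x : measurable (s t @^-1` [set x] : set (measurableTypeR R)).
  have -> : s t @^-1` [set x] = \bigcup_(b in setT) (X t @^-1` [set (x, b)]).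
    apply/seteqP; split => u /=.
      by move=> <-; exists (a t u) => //=; rewrite /s /a -surjective_pairing.
    by move=> [b _ /= ux]; rewrite /s ux.
  by apply: fin_bigcup_measurable => // b _; exact: mX.
have ma t b : measurable (a t @^-1` [set b] : set (measurableTypeR R)).
  have -> : a t @^-1` [set b] = \bigcup_(x in setT) (X t @^-1` [set (x, b)]).
    apply/seteqP; split => u /=.
      by move=> <-; exists (s t u) => //=; rewrite /s /a -surjective_pairing.
    by move=> [x _ /= ux]; rewrite /a ux.
  by apply: fin_bigcup_measurable => // x _; exact: mX.
pose H n z : set (measurableTypeR R) :=
  [set u | forall i, (i < n)%N -> X i u = z i].
have HS n z : H n.+1 z = H n z `&` X n @^-1` [set z n].
  apply/seteqP; split => u /=.
    by move=> h; split; [move=> i /ltnW; exact: h|exact: h].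
  move=> [h hn] i; rewrite ltnS leq_eqVlt => /orP[/eqP -> //|]; exact: h.
have mH n z : measurable (H n z).
  elim: n => [|n IH]; last by rewrite HS; apply: measurableI.
  suff -> : H 0%N z = setT by [].
  by apply/seteqP; split.
have unifH n z : unifP R (H n z) = (\prod_(i < n) step (mkseq z i) (z i))%:E.
  exact: unif_proc.
have histE n (x : nat -> S) (b : nat -> A) :
    history s a n x b = H n (fun i => (x i, b i)).
  apply/seteqP; split => u /= h i /h; first by move=> [<- <-];
    rewrite /s /a -surjective_pairing.
  by rewrite /s /a => ->.
have key n z y : unifP R (H n z `&` s n @^-1` [set y]) =
    ((\prod_(i < n) step (mkseq z i) (z i)) * next_state (mkseq z n) y)%:E.
  pose zb b i := if i == n then (y, b) else z i.
  have zbE b i : (i < n)%N -> zb b i = z i by move=> i_n; rewrite /zb ltn_eqF.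
  have -> : H n z `&` s n @^-1` [set y] = \bigcup_(b in setT) H n.+1 (zb b).
    apply/seteqP; split => u /=.
      move=> [h hy]; exists (a n u) => //= i; rewrite ltnS leq_eqVlt.
      case/orP=> [/eqP ->|i_n]; last by rewrite zbE// h.
      by rewrite /zb eqxx -hy /s /a -surjective_pairing.
    move=> [b _ /= h]; split; last by rewrite /s h// /zb eqxx.
    by move=> i i_n; rewrite h ?zbE// ltnW.
  have finA : finite_set [set: A] by exact: finite_finset.
  rewrite measure_fin_bigcup//; last first.
    move=> b c _ _ [u [/= hb hc]].
    by have := hb n (ltnSn n); rewrite hc// /zb eqxx => -[].
  have -> : [set: A] = [set` index_enum A].
    by apply/seteqP; split => b //= _; rewrite mem_index_enum.
  rewrite -fsbig_seq ?index_enum_uniq//=.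
  under eq_bigr => b _.
    rewrite unifH big_ord_recr/=.
    have -> : \prod_(i < n) step (mkseq (zb b) i) (zb b i) =
        \prod_(i < n) step (mkseq z i) (z i).
      apply: eq_bigr => i _; rewrite zbE//; congr (step_pmf _ _).
      by apply: eq_mkseq => j ji; rewrite zbE// (ltn_trans ji).
    rewrite (eq_mkseq (z' := z)); last by move=> j /zbE.
    rewrite {1}/zb eqxx /step_pmf/= mulrA.
    over.
  by rewrite sumEFin -mulr_sumr pmf_sum1 mulr1.
have histP n (x : nat -> S) (b : nat -> A) :
    history s a n x b `&` s n @^-1` [set x n] `&` a n @^-1` [set b n] =
    history s a n.+1 x b.
  rewrite !histE HS -setIA; congr (_ `&` _); apply/seteqP; split => u /=.
    by rewrite /s /a => -[<- <-]; rewrite -surjective_pairing.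
  by rewrite /s /a => ->.
constructor; apply: (@Trajectory _ _ _ M pi _ _ (unifP R) s a ms ma).
- move=> x; have := key 0%N (fun=> (x0, b0)) x.
  rewrite big_ord0 mul1r /= => <-; congr (unifP R _).
  by apply/seteqP; split => u //= [].
- move=> n x b; rewrite histP !histE unifH key big_ord_recr/= -EFinM.
  by rewrite /step_pmf/= mulrA.
- by move=> n x b; rewrite !histE unifH key next_stateS -EFinM.
Qed.

End existence.

End TrajectoryExistence.

(* Main.v *)
(* The performance J(p) equals E_(d_0)[f] + sum_s d_p(s) sum_a p(a|s) A(s,a),
   since the terms involving f telescope along the trajectory.  Put
   k(s) = sum_a pi'(a|s) A(s,a).  Then J(pi') - J(pi) - G is the difference of
   the integrals of k against d_(pi') and d_pi; |k| <= delta + epsilon, and the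
   two occupation measures agree at time 0, so that they differ in l^1 norm by
   at most 2 gamma / (1 - gamma). *)
Require Import Defs.
From mathcomp Require Import all_boot all_order all_algebra.
From mathcomp Require Import all_classical all_reals all_analysis.
From mathcomp Require Import measurable_realfun ring lra.
Import Order.TTheory GRing.Theory Num.Theory.
Import numFieldNormedType.Exports.
Local Open Scope classical_set_scope.
Local Open Scope ring_scope.

(** * Series with geometric weights and bounded terms *)

Section discounted_series.
Context {R : realType}.
Variables (g : R) (g_ge0 : 0 <= g) (g_lt1 : g < 1).

Let norm_g_lt1 : `|g| < 1.
Proof. by rewrite ger0_norm. Qed.

Lemma sum_expr_le n : \sum_(0 <= t < n) g ^+ t <= (1 - g)^-1.
Proof.
have g1 : g != 1 by rewrite lt_eqF.
have : series (geometric 1 g) n = \sum_(0 <= t < n) g ^+ t.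
  by rewrite /series/=; apply: eq_bigr => i _; rewrite mul1r.
rewrite geometric_seriesE//= => <-.
rewrite mul1r ler_piMl ?invr_ge0 ?subr_ge0 ?(ltW g_lt1)//.
by rewrite gerBl exprn_ge0.
Qed.

Lemma series_discounted_le (u : R^nat) C n : (forall t, `|u t| <= C) ->
  `|series (fun t => g ^+ t * u t) n| <= C / (1 - g).
Proof.
move=> uC; apply: le_trans (ler_norm_sum _ _ _) _.
have C0 : 0 <= C by exact: le_trans (uC 0%N).
apply: (@le_trans _ _ (\sum_(0 <= t < n) C * g ^+ t)).
  apply: ler_sum => t _; rewrite normrM ger0_norm ?exprn_ge0// mulrC.
  by rewrite ler_wpM2r ?exprn_ge0.
by rewrite -mulr_sumr ler_wpM2l// sum_expr_le.
Qed.

Lemma cvg_series_discounted (u : R^nat) C : (forall t, `|u t| <= C) ->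
  cvgn (series (fun t => g ^+ t * u t)).
Proof.
move=> uC; apply: normed_cvg.
apply: (@series_le_cvg _ _ (geometric C g)) => [n|n|n|].
- exact: normr_ge0.
- by rewrite /= mulr_ge0 ?exprn_ge0// (le_trans _ (uC n)).
- by rewrite /= normrM (ger0_norm (exprn_ge0 _ _))// mulrC ler_wpM2r ?exprn_ge0.
- exact: is_cvg_geometric_series.
Qed.

End discounted_series.

(** * Random elements with values in a finite type *)

Section finite_valued.
Context {d} {T : measurableType d} {R : realType} {P : probability T R}.
Context {Z : finType} {g : T -> Z}.
Hypothesis mg : forall z, measurable (g @^-1` [set z]).

(** Law of total probability, applied below with [g] the past, the current pair or the current
    state. *)
Lemma probability_partition (A : set T) : measurable A ->
  P A = (\sum_z P (A `&` g @^-1` [set z]))%E.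
Proof.
move=> mA; have {1}-> : A = \bigcup_(z in setT) (A `&` g @^-1` [set z]).
  by apply/seteqP; split => [w Aw|w [z _ []]//]; exists (g w).
rewrite measure_fin_bigcup; first last.
- by move=> z _; exact: measurableI.
- by move=> i j _ _ [w [[_ <-] [_ <-]]].
- exact: finite_finset.
rewrite (fsbigE (index_enum Z)) ?index_enum_uniq//=.
  by apply: eq_bigl => z; rewrite in_setT.
by move=> z _; rewrite mem_index_enum.
Qed.

(** Writing [phi \o g] as a simple function reduces its measurability, integrability and integral to
    those of indicators. *)
Let finite_valuedE (phi : Z -> R) w :
  phi (g w) = \sum_z phi z * \1_(g @^-1` [set z]) w.
Proof.
rewrite (bigD1 (g w))//= big1 ?addr0 => [|z zg].
  by rewrite indicE mem_set// mulr1.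
by rewrite indicE memNset ?mulr0// => /= gz; rewrite gz eqxx in zg.
Qed.

Lemma measurable_finite_valued (phi : Z -> R) :
  measurable_fun setT (fun w => phi (g w)).
Proof.
under eq_fun do rewrite finite_valuedE.
by apply: measurable_sum => z; exact: measurable_funM.
Qed.

Let integrable_term (phi : Z -> R) z :
  P.-integrable setT (fun w => (phi z * \1_(g @^-1` [set z]) w)%:E).
Proof.
under eq_fun do rewrite EFinM.
by apply: integrableZl => //; exact: integrable_indic.
Qed.

Lemma integral_finite_valued (phi : Z -> R) :
  (\int[P]_w (phi (g w))%:E = (\sum_z phi z * fine (P (g @^-1` [set z])))%:E)%E.
Proof.
under eq_integral do rewrite finite_valuedE -sumEFin.
rewrite integral_sum// -sumEFin; apply: eq_bigr => z _.
under eq_integral do rewrite EFinM.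
rewrite integralZl//; last exact: integrable_indic.
by rewrite integral_indic// setIT EFinM fineK// fin_num_measure.
Qed.

Lemma integrable_finite_valued (phi : Z -> R) :
  P.-integrable setT (fun w => (phi (g w))%:E).
Proof.
under eq_fun do rewrite finite_valuedE -sumEFin.
exact: integrable_sum.
Qed.

End finite_valued.

(** * Laws of states and state-action pairs along a trajectory *)

Definition policy_mean {R : realType} {S A : finType} (p : policy R S A)
  (h : S -> A -> R) x := \sum_b p x b * h x b.

Section trajectory.
Context {R : realType} {S A : finType} {M : mdp R S A} {p : policy R S A}.
Variable X : trajectory M p.
Local Notation P := (prob X).

Definition pair_at t w := (state X t w, action X t w).

(** [dstate X x] is by definition the limit of the discounted partial sums of [occ t x]. *)
Definition occ t x := fine (P (state X t @^-1` [set x])).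

Definition occ_mean t (h : S -> R) := \sum_x occ t x * h x.

Lemma measurable_pair t z : measurable (pair_at t @^-1` [set z]).
Proof.
have -> : pair_at t @^-1` [set z] =
    state X t @^-1` [set z.1] `&` action X t @^-1` [set z.2].
  apply/seteqP; split => [w /= <-//|w /= [sw aw]].
  by rewrite /pair_at sw aw -surjective_pairing.
by apply: measurableI; [exact: measurable_state|exact: measurable_action].
Qed.

(* Padding a past of length n with z makes z the pair at time n, so that the
   laws of the trajectory apply to (ext n h z) with that final pair. *)
Let ext n (h : {ffun 'I_n -> S * A}) z i : S * A :=
  if insub i is Some j then h j else z.

Let ext_ge n (h : {ffun 'I_n -> S * A}) z i : (n <= i)%N -> ext n h z i = z.
Proof. by move=> ni; rewrite /ext insubF// ltnNge ni. Qed.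

(** Pasts are encoded in a finite type so that [probability_partition] can sum over them. *)
Let past n w : {ffun 'I_n -> S * A} := [ffun i : 'I_n => pair_at i w].

(** The padding [z] is arbitrary here: [history] reads only indices below [n]. *)
Let past_history n h z : past n @^-1` [set h] =
  history (state X) (action X) n (fun i => (ext n h z i).1)
                                 (fun i => (ext n h z i).2).
Proof.
apply/seteqP; split => [w <- i i_n|w hw].
  by rewrite /ext insubT ffunE.
apply/ffunP => i; rewrite ffunE /pair_at.
have [-> ->] := hw i (ltn_ord i).
by rewrite /ext valK -surjective_pairing.
Qed.

Let measurable_past n h : measurable (past n @^-1` [set h]).
Proof.
have -> : past n @^-1` [set h] =
    \bigcap_(i in setT) (pair_at (i : 'I_n) @^-1` [set h i]).
  apply/seteqP; split => [w <- i _ /=|w hw]; first by rewrite ffunE.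
  by apply/ffunP => i; rewrite ffunE; exact: hw.
by apply: fin_bigcap_measurable => // i _; exact: measurable_pair.
Qed.

(** [law_action] conditions on the whole past, but its factor depends only on [z]; summing over all
    pasts removes the conditioning. *)
Lemma prob_pair t z :
  P (pair_at t @^-1` [set z]) =
  (P (state X t @^-1` [set z.1]) * (p z.1 z.2)%:E)%E.
Proof.
rewrite (probability_partition (measurable_past t) _ (measurable_pair t z)).
rewrite (probability_partition (measurable_past t) _
  (measurable_state X t z.1)).
rewrite ge0_sume_distrl//.
apply: eq_bigr => h _; rewrite (past_history t h z).
have := law_action X t (fun i => (ext t h z i).1) (fun i => (ext t h z i).2).
rewrite !ext_ge// => L; rewrite [in RHS]setIC -L.
congr (P _); apply/seteqP; split => [w [<- hw]|w [[hw sw] aw]]; split => //=.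
by move: sw aw => /=; rewrite /pair_at => -> ->; rewrite -surjective_pairing.
Qed.

(** Markov property: the transition factor is the same for every past, so it comes out of the sum
    over pasts. *)
Lemma prob_pair_state t z y :
  P (pair_at t @^-1` [set z] `&` state X t.+1 @^-1` [set y]) =
  (P (pair_at t @^-1` [set z]) * (trans M z.1 z.2 y)%:E)%E.
Proof.
have mzy := measurableI _ _ (measurable_pair t z) (measurable_state X t.+1 y).
rewrite (probability_partition (measurable_past t) _ mzy).
rewrite (probability_partition (measurable_past t) _ (measurable_pair t z)).
rewrite ge0_sume_distrl//.
apply: eq_bigr => h _.
(* The padded past is constantly [z] from time [t] on, so the state at time [t.+1] must be
   overwritten with [y]. *)
pose x i := if i == t.+1 then y else (ext t h z i).1.
pose b i := (ext t h z i).2.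
have := law_state X t x b.
have -> : history (state X) (action X) t.+1 x b =
    pair_at t @^-1` [set z] `&` past t @^-1` [set h].
  rewrite (past_history t h z); apply/seteqP; split => [w H|w [zw H] i].
    split.
      have [] := H t (ltnSn t).
      rewrite /x /b ltn_eqF// ext_ge// /pair_at/= => -> ->.
      by rewrite -surjective_pairing.
    move=> i i_t; have [] := H i (ltnW i_t).
    by rewrite /x ltn_eqF// ltnW.
  rewrite ltnS leq_eqVlt => /orP[/eqP ->|i_t].
    by rewrite /x /b ltn_eqF// ext_ge// -zw.
  by have := H i i_t; rewrite /x ltn_eqF// ltnW.
rewrite /x /b eqxx ltn_eqF// !ext_ge// => <-.
by rewrite setIAC.
Qed.

Lemma occE t x : (occ t x)%:E = P (state X t @^-1` [set x]).
Proof. by rewrite fineK// fin_num_measure//; exact: measurable_state. Qed.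

Lemma occ_init x : occ 0 x = init M x.
Proof. by rewrite /occ law_init. Qed.

Lemma occ_ge0 t x : 0 <= occ t x.
Proof. exact: fine_ge0. Qed.

Lemma occ_sum1 t : \sum_x occ t x = 1.
Proof.
apply: EFin_inj; rewrite -sumEFin -(probability_setT P).
rewrite (probability_partition (measurable_state X t) _ measurableT).
by apply: eq_bigr => x _; rewrite setTI occE.
Qed.

Lemma fine_prob_pair t z :
  fine (P (pair_at t @^-1` [set z])) = occ t z.1 * p z.1 z.2.
Proof. by rewrite prob_pair -occE -EFinM. Qed.

(** Forward Kolmogorov equation, obtained by splitting on the pair at time [t]. *)
Lemma occ_step t y :
  occ t.+1 y = occ_mean t (policy_mean p (fun x b => trans M x b y)).
Proof.
apply: EFin_inj; rewrite occE.
rewrite (probability_partition (measurable_pair t) _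
  (measurable_state X t.+1 y)).
under eq_bigr do rewrite setIC prob_pair_state prob_pair -occE -!EFinM.
rewrite sumEFin; congr EFin; rewrite /occ_mean /policy_mean.
under [RHS]eq_bigr do rewrite mulr_sumr.
by rewrite pair_bigA; apply: eq_bigr => z _; rewrite mulrA.
Qed.

(** Dual form of [occ_step]: exchanging sums moves the transition operator from the law onto the
    test function. *)
Lemma occ_mean_step t h :
  occ_mean t.+1 h =
  occ_mean t (policy_mean p (fun x b => \sum_y trans M x b y * h y)).
Proof.
rewrite /occ_mean; under eq_bigr do rewrite occ_step mulr_suml.
rewrite exchange_big/=; apply: eq_bigr => x _.
under eq_bigr do rewrite -mulrA.
rewrite -mulr_sumr /policy_mean; congr (_ * _).
under eq_bigr do rewrite mulr_suml.
rewrite exchange_big/=; apply: eq_bigr => b _.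
by rewrite mulr_sumr; apply: eq_bigr => y _; rewrite mulrA.
Qed.

Lemma norm_occ_mean_le t h C :
  (forall x, `|h x| <= C) -> `|occ_mean t h| <= C.
Proof.
move=> hC; apply: le_trans (ler_norm_sum _ _ _) _.
rewrite -[leRHS]mul1r -(occ_sum1 t) mulr_suml; apply: ler_sum => x _.
by rewrite normrM ger0_norm ?occ_ge0// ler_wpM2l// occ_ge0.
Qed.

(** * Discounted occupation measure and return as limits of series *)

Lemma cvg_dstate_mean (h : S -> R) :
  series (fun t => discount M ^+ t * occ_mean t h) @ \oo -->
  \sum_x dstate X x * h x.
Proof.
have -> : series (fun t => discount M ^+ t * occ_mean t h) = fun n =>
    \sum_x series (fun t => discount M ^+ t * occ t x) n * h x.
  apply/funext => n; rewrite /series/=.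
  under [RHS]eq_bigr do rewrite mulr_suml.
  rewrite exchange_big/=; apply: eq_bigr => t _.
  by rewrite mulr_sumr; apply: eq_bigr => x _; rewrite mulrA.
apply: cvg_big => [|x _]; first exact: add_continuous.
have cv : series (fun t => discount M ^+ t * occ t x) @ \oo --> dstate X x.
  (* The bound 1 holds because a single state carries at most the total mass. *)
  apply: (cvg_series_discounted _ (discount_ge0 M) (discount_lt1 M) _ 1) => t.
  rewrite ger0_norm ?occ_ge0// -(occ_sum1 t) (bigD1 x)//= lerDl.
  by apply: sumr_ge0 => y _; exact: occ_ge0.
exact: cvgMr_tmp cv.
Qed.

(** Dominated convergence exchanges expectation and infinite sum; the finite partial sums are then
    evaluated through the law of the pair at each time. *)
Lemma cvg_return_mean :
  series (fun t => discount M ^+ t * occ_mean t (policy_mean p (reward M)))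
  @ \oo --> J X.
Proof.
(* The sum of all absolute rewards is a crude uniform bound, so [C / (1 - discount M)] dominates
   every partial return. *)
pose C := \sum_(z : S * A) `|reward M z.1 z.2|.
pose u w t := reward M (state X t w) (action X t w).
pose F n w := series (fun t => discount M ^+ t * u w t) n.
have uC w t : `|u w t| <= C.
  rewrite /C (bigD1 (pair_at t w))//= lerDl.
  exact: sumr_ge0.
have cF w : F ^~ w @ \oo --> limn (F ^~ w).
  exact: cvg_series_discounted (discount_ge0 M) (discount_lt1 M) _ _ (uC w).
pose phi t (z : S * A) := discount M ^+ t * reward M z.1 z.2.
have mF n : measurable_fun setT (F n).
  apply: measurable_sum => t.
  exact: (measurable_finite_valued (measurable_pair t) (phi t)).
have [] := @dominated_convergence _ _ _ P setT measurableT
  (fun n w => (F n w)%:E) (fun w => (limn (F ^~ w))%:E)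
  (cst (C / (1 - discount M))%:E).
- by move=> n; exact/measurable_EFinP.
- apply/measurable_EFinP; exact: measurable_fun_cvg mF (fun w _ => cF w).
- apply: aeW => w _; apply: cvg_EFin; first exact: nearW.
  exact: cF.
- exact: finite_measure_integrable_cst.
- apply: aeW => w n _; rewrite /= lee_fin.
  exact: series_discounted_le (discount_ge0 M) (discount_lt1 M) _ _ _ (uC w).
move=> ilim _ cvgI; have -> : J X = fine (\int[P]_w (limn (F ^~ w))%:E).
  by rewrite /J unlock.
(* Integrability of the limit makes its integral finite, so the convergence passes from extended
   reals to [R]. *)
move: cvgI; rewrite -[X in _ --> X](fineK (integrable_fin_num _ ilim))//.
move=> /fine_cvg; apply: cvg_trans; apply: near_eq_cvg; apply: nearW => n /=.
under eq_integral do rewrite /F /series/= -sumEFin.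
rewrite integral_sum//= => [|t]; last first.
  exact: (integrable_finite_valued (measurable_pair t) (phi t)).
under eq_bigr => t _.
  rewrite (integral_finite_valued (measurable_pair t) (phi t)).
  over.
rewrite sumEFin/= /series/=; apply: eq_bigr => t _.
rewrite /occ_mean mulr_sumr /policy_mean.
under [RHS]eq_bigr do rewrite 2!mulr_sumr.
rewrite pair_bigA/=; apply: eq_bigr => z _.
by rewrite fine_prob_pair /phi; ring.
Qed.

(** * Performance expressed through [adv] *)

Lemma occ_mean_adv t f :
  occ_mean t (policy_mean p (adv M f)) =
  occ_mean t (policy_mean p (reward M)) +
  (discount M * occ_mean t.+1 f - occ_mean t f).
Proof.
rewrite occ_mean_step /occ_mean mulr_sumr -sumrB -big_split/=.
apply: eq_bigr => x _; rewrite mulrCA -mulrBr -mulrDr; congr (_ * _).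
(* Spreading [f x] over the unit mass of [p x] allows a comparison action by action. *)
rewrite -[f x]mul1r -(pmf_sum1 (p x)) mulr_suml /policy_mean mulr_sumr.
rewrite -sumrB -big_split/=; apply: eq_bigr => b _.
by rewrite /adv; ring.
Qed.

(** Weighted by powers of the discount, the differences in [occ_mean_adv] leave only boundary terms
    at times 0 and [n]; the latter tends to 0. *)
Lemma J_adv f :
  J X = \sum_x init M x * f x + \sum_x dstate X x * policy_mean p (adv M f) x.
Proof.
have fle x : `|f x| <= \sum_y `|f y|.
  by rewrite (bigD1 x)//= lerDl sumr_ge0.
(* These are the terms of a convergent series, [f] being bounded on the finite state set. *)
have tail : discount M ^+ n * occ_mean n f @[n --> \oo] --> 0.
  exact: cvg_series_cvg_0 (cvg_series_discounted _ (discount_ge0 M)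
    (discount_lt1 M) _ _ (fun t => norm_occ_mean_le t _ _ fle)).
have -> : \sum_x init M x * f x = occ_mean 0 f.
  by apply: eq_bigr => x _; rewrite occ_init.
have telescope n :
    series (fun t => discount M ^+ t * occ_mean t (policy_mean p (adv M f))) n =
    series (fun t => discount M ^+ t * occ_mean t (policy_mean p (reward M))) n
    + discount M ^+ n * occ_mean n f - occ_mean 0 f.
  elim: n => [|n IH].
    by rewrite /series/= !big_geq// expr0; ring.
  by rewrite !seriesSr IH occ_mean_adv exprS; ring.
have /(cvg_unique (@Rhausdorff R)) := cvg_dstate_mean (policy_mean p (adv M f)).
have lim_adv :
    series (fun t => discount M ^+ t * occ_mean t (policy_mean p (adv M f)))
    @ \oo --> J X + 0 - occ_mean 0 f.
  under eq_cvg do rewrite telescope.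
  by apply: cvgB; [apply: cvgD => //; exact: cvg_return_mean|exact: cvg_cst].
by move=> /(_ _ lim_adv) ->; ring.
Qed.

End trajectory.

(** * Comparison of two policies *)

(* Both occupation measures start from the initial law, so only the terms with
   t >= 1 contribute, whence the factor [discount M] in the bound. *)
Lemma dstate_mean_dist {R : realType} {S A : finType} {M : mdp R S A}
    {p q : policy R S A} (X : trajectory M p) (Y : trajectory M q)
    (k : S -> R) (C : R) : (forall x, `|k x| <= C) ->
  `|\sum_x dstate Y x * k x - \sum_x dstate X x * k x| <=
  2 * discount M / (1 - discount M) * C.
Proof.
move=> kC.
pose v t := occ_mean Y t k - occ_mean X t k.
have vC t : `|v t| <= 2 * C.
  apply: le_trans (ler_normB _ _) _; rewrite mulr_natl mulr2n.
  by apply: lerD; exact: norm_occ_mean_le.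
have lim_diff : series (fun t => discount M ^+ t * occ_mean Y t k) \-
    series (fun t => discount M ^+ t * occ_mean X t k) @ \oo -->
    \sum_x dstate Y x * k x - \sum_x dstate X x * k x.
  exact: cvgB (cvg_dstate_mean Y k) (cvg_dstate_mean X k).
apply: (cvgr_to_le (cvg_norm lim_diff)).
apply: nearW => n /=.
have -> : series (fun t => discount M ^+ t * occ_mean Y t k) n -
    series (fun t => discount M ^+ t * occ_mean X t k) n =
    series (fun t => discount M ^+ t * v t) n.
  by rewrite /series/= -sumrB; apply: eq_bigr => t _; rewrite mulrBr.
(* Nonnegativity of [C] settles the empty partial sum, which has no term at time 0 to split off. *)
have C0 : 0 <= C by have := le_trans (normr_ge0 _) (vC 0%N); rewrite pmulr_rge0.
have d1 : 0 <= (1 - discount M)^-1.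
  by rewrite invr_ge0 subr_ge0 ltW ?discount_lt1.
case: n => [|n].
  rewrite /series/= big_geq// normr0.
  by rewrite !mulr_ge0 ?discount_ge0.
have -> : series (fun t => discount M ^+ t * v t) n.+1 =
    discount M * series (fun t => discount M ^+ t * v t.+1) n.
  rewrite /series/= big_nat_recl//= /v /occ_mean.
  (* At time 0 both means are taken under [init M], so they cancel. *)
  under [X in _ - X]eq_bigr do rewrite occ_init.
  under [X in X - _]eq_bigr do rewrite occ_init.
  rewrite subrr mulr0 add0r mulr_sumr.
  by apply: eq_bigr => t _; rewrite exprS mulrA.
rewrite normrM ger0_norm ?discount_ge0//.
rewrite (_ : 2 * _ / _ * C = discount M * (2 * C / (1 - discount M))).
  apply: ler_wpM2l; first exact: discount_ge0.
  exact: series_discounted_le (discount_ge0 M) (discount_lt1 M) _ _ _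
    (fun t => vC t.+1).
by ring.
Qed.

Theorem theorem3p3 (R : realType) (S A : finType) (M : mdp R S A)
    (f : S -> R) (pi pi' : policy R S A)
    (pi_gt0 : forall x b, 0 < pi x b)
    (X : trajectory M pi) (Y : trajectory M pi') :
  J Y - J X >= G f pi' X
    - 2 * discount M / (1 - discount M) * (delta M f pi pi' + epsilon M f pi).
Proof.
pose a x := policy_mean pi (adv M f) x.
pose g x := \sum_b pi x b * ((pi' x b / pi x b - 1) * adv M f x b).
(* Importance weighting: positivity of [pi] lets the ratio turn the mean under [pi] into one under
   [pi']. *)
have ratio x : policy_mean pi' (adv M f) x = g x + a x.
  rewrite -big_split/=; apply: eq_bigr => b _.
  by field; rewrite gt_eqF.
have g_le x : `|g x| <= delta M f pi pi'.
  apply: le_trans (ler_norm_sum _ _ _) _.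
  (* [g x] is an average under [pi x] of terms bounded by [delta]. *)
  rewrite -[leRHS]mul1r -[X in _ <= X * _](pmf_sum1 (pi x)) mulr_suml.
  apply: ler_sum => b _; have pi_ge0 := ltW (pi_gt0 x b).
  rewrite normrM ger0_norm// ler_wpM2l//.
  exact: (le_bigmax 0 (fun z : S * A =>
    `|(pi' z.1 z.2 / pi z.1 z.2 - 1) * adv M f z.1 z.2|) (x, b)).
have a_le x : `|a x| <= epsilon M f pi.
  exact: (le_bigmax 0 (fun x => `|policy_mean pi (adv M f) x|) x).
have k_le x : `|g x + a x| <= delta M f pi pi' + epsilon M f pi.
  by apply: le_trans (ler_normD _ _) _; exact: lerD.
have := dstate_mean_dist X Y _ _ k_le.
(* Only the lower bound on the difference matters. *)
rewrite ler_norml => /andP[+ _].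
rewrite (J_adv X f) (J_adv Y f).
(* The [init M] terms cancel in the difference; splitting the integral of [g + a] against [dstate X]
   isolates [G] and the integral from [J X]. *)
under [\sum_x dstate Y x * policy_mean _ _ _]eq_bigr do rewrite ratio.
under [\sum_x dstate X x * (g x + a x)]eq_bigr do rewrite mulrDr.
rewrite big_split/= /G -/g /a.
lra.
Qed.
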